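(* Let $(x_1,y_1),\dots,(x_N,y_N)\in\mathbb{R}^2$ be given data points, with associated vectors $P_i\in\mathbb{R}^8$ and matrix $P=(p_{jk})\in\mathbb{R}^{8\times 8}$ (see context). Put $P_0^{al}=p_{22}\in\mathbb{R}$, $P_1^{al}=\begin{pmatrix}p_{23}&p_{24}&p_{25}&p_{26}\end{pmatrix}$ (a $1\times 4$ row), $P_c=(p_{jk})_{3\le j,k\le 6}\in\mathbb{R}^{4\times 4}$, and assume $P_0^{al}\neq 0$. Consider the optimisation problem of minimising $$Q^{al}\mapsto \sum_{i=1}^N (P_i\cdot Q^{al})^2$$ over all vectors of the form $Q^{al}=\begin{pmatrix}0&\bar v^-&\bar v^+&v^1&v^2&v^+&0&0\end{pmatrix}^T\in\mathbb{R}^8$ subject to the constraint $(Q^{al})^2:=Q^{al}\cdot Q^{al}=1$. Then the solution is given by $Q^{al}=\begin{pmatrix}0&w^{al}&v^T&0&0\end{pmatrix}^T$, where $v=\begin{pmatrix}\bar v^+&v^1&v^2&v^+\end{pmatrix}^T\in\mathbb{R}^4$ is an eigenvector, normalised by $v^TB_cv=1$, corresponding to the minimal non-negative eigenvalue of $$P_{con}^{al}=B_c\left(P_c-(P_1^{al})^T(P_0^{al})^{-1}P_1^{al}\right),$$ and $w^{al}=\bar v^-$ is the real number $w^{al}=-(P_0^{al})^{-1}P_1^{al}v$.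
   Context: On $\mathbb{R}^8$ (the vector space $\mathbb{R}^{5,3}$ underlying Geometric Algebra for Conics, with coordinates ordered as $\bar n_\times,\bar n_-,\bar n_+,e_1,e_2,n_+,n_-,n_\times$) the inner product is $X\cdot Y=X^TBY$, where $B$ is the symmetric $8\times 8$ matrix with $B_{44}=B_{55}=1$, $B_{j,9-j}=-1$ for $j\in\{1,2,3,6,7,8\}$, and all other entries zero. The matrix $B_c$ is the central $4\times4$ block of $B$ (rows and columns 3 to 6): $$B_c=\begin{pmatrix}0&0&0&-1\\0&1&0&0\\0&0&1&0\\-1&0&0&0\end{pmatrix}.$$ A point $(x_i,y_i)$ is represented by $$P_i=\begin{pmatrix}0&0&1&x_i&y_i&\tfrac12(x_i^2+y_i^2)&\tfrac12(x_i^2-y_i^2)&x_iy_i\end{pmatrix}^T,$$ and $P=\sum_{i=1}^N BP_iP_i^TB$, a symmetric $8\times 8$ matrix, so that $\sum_i(P_i\cdot Q)^2=Q^TPQ$. ''Solution'' of the optimisation problem means a (global) minimiser of the objective function on the set of admissible vectors satisfying the constraint.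
   Formalization: That every solution has the stated form is proved assuming some eigenvector v for the minimal non-negative eigenvalue can be normalised by v^T B_c v = 1; such v is shown to exist only if 0 is not an eigenvalue of P_con, as it may fail otherwise (e.g. (±1,0), (±3,±2)). *)

(* Defs.v *)
From HB Require Import structures.
From mathcomp Require Import all_boot all_order all_algebra.
From mathcomp Require Import reals.

Set Implicit Arguments.
Unset Strict Implicit.
Unset Printing Implicit Defensive.

Import Order.TTheory GRing.Theory Num.Theory.
Local Open Scope ring_scope.

(* Coordinates of R^8 are 0-based here: the
   coordinate with (1-based) number j in the basis
   (nbar_x, nbar_-, nbar_+, e_1, e_2, n_+, n_-, n_x) has index j - 1 : 'I_8. *)

Definition gacB (R : realType) : 'M[R]_8 :=
  \matrix_(j, k)
    if (val j \in [:: 3; 4]%N) && (k == j) then 1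
    else if (val j \notin [:: 3; 4]%N) && (j + k == 7)%N then -1
    else 0.

Definition ginner (R : realType) (X Y : 'cV[R]_8) : R :=
  (X^T *m gacB R *m Y) 0 0.

(* The index embedding of the central block (1-based positions 3 to 6). *)
Definition mid (k : 'I_4) : 'I_8 := inord k.+2.

Definition gacBc (R : realType) : 'M[R]_4 := mxsub mid mid (gacB R).

Definition cpoint (R : realType) (x y : R) : 'cV[R]_8 :=
  \col_(j < 8) [:: 0; 0; 1; x; y; 2^-1 * (x ^+ 2 + y ^+ 2);
                   2^-1 * (x ^+ 2 - y ^+ 2); x * y]`_j.

Definition dataP (R : realType) (N : nat) (x y : 'I_N -> R) : 'M[R]_8 :=
  \sum_(i < N) gacB R *m cpoint (x i) (y i) *m (cpoint (x i) (y i))^T *m gacB R.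

(* The entry p_22 and the row (p_23 p_24 p_25 p_26), in 1-based numbering. *)
Definition P0al (R : realType) (P : 'M[R]_8) : R := P (inord 1) (inord 1).

Definition P1al (R : realType) (P : 'M[R]_8) : 'rV[R]_4 :=
  \row_(k < 4) P (inord 1) (mid k).

Definition Pc (R : realType) (P : 'M[R]_8) : 'M[R]_4 := mxsub mid mid P.

Definition Pcon (R : realType) (P : 'M[R]_8) : 'M[R]_4 :=
  gacBc R *m (Pc P - (P1al P)^T *m ((P0al P)^-1 *: P1al P)).

(* v lists (vbar^+, v^1, v^2, v^+), and w is vbar^-. *)
Definition Qal (R : realType) (w : R) (v : 'cV[R]_4) : 'cV[R]_8 :=
  \col_(j < 8) [:: 0; w; v (inord 0) 0; v (inord 1) 0; v (inord 2) 0;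
                   v (inord 3) 0; 0; 0]`_j.

Definition wal (R : realType) (P : 'M[R]_8) (v : 'cV[R]_4) : R :=
  - ((P0al P)^-1 * (P1al P *m v) 0 0).

Definition objective (R : realType) (N : nat) (x y : 'I_N -> R)
    (Q : 'cV[R]_8) : R :=
  \sum_(i < N) (ginner (cpoint (x i) (y i)) Q) ^+ 2.

Definition feasible (R : realType) (Q : 'cV[R]_8) : Prop :=
  (exists w v, Q = Qal w v) /\ ginner Q Q = 1.

Definition is_solution (R : realType) (N : nat) (x y : 'I_N -> R)
    (Q : 'cV[R]_8) : Prop :=
  feasible Q /\
  forall Q', feasible Q' -> objective x y Q <= objective x y Q'.

Definition min_nonneg_eigenvalue (R : realType) (n : nat) (M : 'M[R]_n)
    (lam : R) : Prop :=
  [/\ eigenvalue M lam, 0 <= lam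
    & forall mu, eigenvalue M mu -> 0 <= mu -> lam <= mu].

(* Eigenvectors are columns, M v = lam v; the library's eigenvalue is phrased
   with row eigenvectors, which gives the same eigenvalues.  The normalisation
   makes v nonzero. *)
Definition normalised_min_eigenvector (R : realType) (M : 'M[R]_4)
    (v : 'cV[R]_4) : Prop :=
  (exists2 lam, min_nonneg_eigenvalue M lam & M *m v = lam *: v) /\
  (v^T *m gacBc R *m v) 0 0 = 1.

(* Main.v *)
From HB Require Import structures.
From mathcomp Require Import all_boot all_order all_algebra.
From mathcomp Require Import classical_sets reals topology normedtype derive.
From mathcomp Require Import ring lra.
Require Import Defs.

Set Implicit Arguments.
Unset Strict Implicit.
Unset Printing Implicit Defensive.

Import Order.TTheory GRing.Theory Num.Theory.
Import numFieldNormedType.Exports.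
Local Open Scope ring_scope.

(** Write [S] for the Schur complement of [P0al] in the block of [P] indexed by
    the coordinates 2 to 6, and [B] for [gacBc]; thus [Pcon P = B S].  On the
    admissible vectors, completing the square in the coordinate [w] gives
      [objective (Qal w v) = P0al * (w - wal v)^2 + v^T S v],
    while the constraint, which does not see [w], reads [v^T B v = 1]
    ([objective_Qal], [ginner_Qal]).  The objective is a sum of squares, so
    [P0al > 0] and [S] is positive semidefinite; the best [w] is [wal v], and it
    remains to minimise [v^T S v] subject to [v^T B v = 1].

    As [B] is an involution, [B S v = a v] means [S v = a B v], and such a
    [v] on the constraint has value [v^T S v = a].  So everything follows once
    the minimal nonnegative eigenvalue [lam] is shown to exist and to satisfy
    [lam * v^T B v <= v^T S v] for all [v] ([pencil_min_eigenvalue]).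
    If 0 is an eigenvalue, then [lam = 0] and the inequality says that [S] is
    positive semidefinite.  Otherwise [S] is positive definite and the quotient
    [v^T B v / v^T S v] attains a maximum [mu] by compactness of the unit sphere
    ([rayleigh_max]); [mu > 0] since [B] is not negative semidefinite, and
    [lam = mu^-1].

    Conversely, a vector at which this inequality is an equality is a zero of
    the positive semidefinite form [S - lam B], hence is in its kernel
    ([psd_kernel]), that is, an eigenvector for [lam]; this identifies all
    minimisers. *)

(** * Quadratic forms *)

Definition qform (R : comNzRingType) n (A : 'M[R]_n) (u : 'cV[R]_n) : R :=
  (u^T *m A *m u) 0 0.

Lemma qformE (R : comNzRingType) n (A : 'M[R]_n) u :
  qform A u = \sum_j \sum_k u j 0 * A j k * u k 0.
Proof.
rewrite /qform -mulmxA mxE; apply: eq_bigr => j _.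
by rewrite !mxE mulr_sumr; apply: eq_bigr => k _; rewrite mulrA.
Qed.

Lemma qformB (R : comNzRingType) n (A B : 'M[R]_n) u :
  qform (A - B) u = qform A u - qform B u.
Proof. by rewrite /qform mulmxBr mulmxBl !mxE. Qed.

Lemma qformZ (R : comNzRingType) n a (A : 'M[R]_n) u :
  qform (a *: A) u = a * qform A u.
Proof. by rewrite /qform -scalemxAr -scalemxAl mxE. Qed.

Lemma qform_scale (R : comNzRingType) n a (A : 'M[R]_n) u :
  qform A (a *: u) = a ^+ 2 * qform A u.
Proof.
by rewrite /qform -scalemxAr linearZ /= -!scalemxAl !mxE mulrA expr2.
Qed.

Lemma qform_addscale (R : comNzRingType) n t (A : 'M[R]_n) u z : A^T = A ->
  qform A (u + t *: z) =
    qform A u + 2 * t * (z^T *m (A *m u)) 0 0 + t ^+ 2 * qform A z.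
Proof.
move=> symA; have cross : (u^T *m A *m z) 0 0 = (z^T *m (A *m u)) 0 0.
  by rewrite -[u^T *m _ *m _]trmxK mxE !trmx_mul trmxK symA.
rewrite /qform [(_ + _)^T]linearD /= [(_ *: _)^T]linearZ /=.
rewrite !(mulmxDl, mulmxDr) -!(scalemxAl, scalemxAr).
rewrite -(mulmxA z^T A u).
move: (u^T *m A *m u) (z^T *m A *m z) (u^T *m A *m z) (z^T *m (A *m u)) cross.
by move=> a b c d; rewrite !mxE => ->; ring.
Qed.

Lemma sqnorm_ge0 (R : realDomainType) n (z : 'cV[R]_n) : 0 <= (z^T *m z) 0 0.
Proof. by rewrite mxE; apply: sumr_ge0 => i _; rewrite mxE -expr2 sqr_ge0. Qed.

Lemma sqnorm_eq0 (R : realDomainType) n (z : 'cV[R]_n) :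
  (z^T *m z) 0 0 = 0 -> z = 0.
Proof.
rewrite mxE => /psumr_eq0P z0; apply/colP => i; apply/eqP.
rewrite mxE -sqrf_eq0 expr2 -{1}[z]trmxK mxE z0 // => j _.
by rewrite mxE -expr2 sqr_ge0.
Qed.

(** Moving from [u] in the direction [- A u] lowers the form to first order, by
    twice the squared length of [A u]; at a zero of a nonnegative form this is
    possible only if [A u = 0]. *)
Lemma psd_kernel (R : realFieldType) n (A : 'M[R]_n) u : A^T = A ->
  (forall z, 0 <= qform A z) -> qform A u = 0 -> A *m u = 0.
Proof.
move=> symA psdA u0; set z := A *m u.
apply: sqnorm_eq0; have := sqnorm_ge0 z; set a := (_ *m _) 0 0 => a0.
have c0 := psdA z; set c := qform A z in c0.
have c1 : 0 < c + 1 by lra.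
(* The minimum along this line is at [- a / c]; replacing [c] by [c + 1] keeps
   the denominator positive and still gives a negative value if [a > 0]. *)
have := psdA (u + (- (a / (c + 1))) *: z).
rewrite qform_addscale // u0 -/z -/a -/c.
set t := a / (c + 1); have -> : a = t * (c + 1) by rewrite divfK ?gt_eqF.
move=> h; suff -> : t = 0 by rewrite mul0r.
apply/eqP; rewrite -sqrf_eq0; apply/eqP; nra.
Qed.

Lemma qform_continuous (R : realType) n (A : 'M[R]_n) :
  continuous (fun u : 'rV[R]_n => qform A u^T).
Proof.
move=> u.
have -> : (fun u : 'rV[R]_n => qform A u^T) =
    (fun u => \sum_j \sum_k u 0 j * A j k * u 0 k).
  apply/boolp.funext => v; rewrite qformE.
  by apply: eq_bigr => j _; apply: eq_bigr => k _; rewrite !mxE.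
apply: continuous_big => [|j _ {}u]; first exact: add_continuous.
apply: continuous_big => [|k _ {}u]; first exact: add_continuous.
apply: (@continuousM _ _ (fun v : 'rV[R]_n => v 0 j * A j k) (fun v => v 0 k)).
  apply: (@continuousM _ _ (fun v : 'rV[R]_n => v 0 j) (fun=> A j k)).
    exact: coord_continuous.
  exact: cst_continuous.
exact: coord_continuous.
Qed.

(** The quotient of the two forms is invariant under scaling, so its maximum
    over the compact unit sphere is its maximum over all nonzero vectors.  The
    vector [w] provides a point of the sphere. *)
Lemma rayleigh_max (R : realType) n (S B : 'M[R]_n) (w : 'cV[R]_n) :
  w != 0 -> (forall u, u != 0 -> 0 < qform S u) ->
  exists u mu, [/\ u != 0, qform B u = mu * qform S u
    & forall z, qform B z <= mu * qform S z].
Proof.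
move=> w0 Spos.
pose A := [set u : 'rV[R]_n | `|u| = 1]%classic.
pose f (u : 'rV[R]_n) := qform B u^T / qform S u^T.
have trN0 (u : 'rV[R]_n) : u != 0 -> u^T != 0 by rewrite trmx_eq0.
have AN0 u : A u -> u != 0 by move=> /= Au; rewrite -normr_eq0 Au oner_eq0.
have normA (z : 'rV[R]_n) : z != 0 -> A (`|z|^-1 *: z).
  move=> z0; rewrite /A /= normrZ normfV normr_id mulVf //.
  by rewrite normr_eq0.
have cptA : compact A.
  apply: bounded_closed_compact.
    by exists 1; split=> // M M1 u /= ->; exact: ltW.
  apply: (preimage_closed (f := fun u : 'rV[R]_n => `|u|) _ (@closed_eq _ 1)).
  by move=> u _; exact: norm_continuous.
have fcont : ({within A, continuous f})%classic.
  rewrite continuous_subspace_in => u; rewrite inE => Au.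
  have u0 := trN0 _ (AN0 _ Au).
  apply: continuous_subspaceT_for => //.
  apply: continuousM; first exact: qform_continuous.
  apply: continuousV; last exact: qform_continuous.
  by rewrite gt_eqF ?Spos.
have [|u] := EVT_max_rV (A := A) (f := f) _ cptA fcont.
  by exists (`|w^T|^-1 *: w^T); apply: normA; rewrite trmx_eq0.
rewrite inE => /AN0/trN0 u0 fmax.
exists u^T, (f u); split=> // [|z]; first by rewrite divfK ?gt_eqF ?Spos.
have [->|z0] := eqVneq z 0; first by rewrite /qform !mulmx0 mxE mulr0.
have zT0 : z^T != 0 by rewrite trmx_eq0.
have := fmax (`|z^T|^-1 *: z^T); rewrite inE => /(_ (normA _ zT0)).
rewrite {1}/f linearZ /= trmxK !qform_scale -mulf_div divff ?mul1r.
  by rewrite ler_pdivrMr ?Spos.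
by rewrite expf_neq0 // invr_neq0 // normr_eq0.
Qed.

(** * The pencil of two symmetric forms *)

(** [eigenvalue] speaks of row eigenvectors; a matrix and its transpose have
    the same eigenvalues. *)
Lemma eigenvalue_colP (R : fieldType) n (M : 'M[R]_n) a :
  reflect (exists2 y : 'cV_n, M *m y = a *: y & y != 0) (eigenvalue M a).
Proof.
have -> : eigenvalue M a = eigenvalue M^T a.
  rewrite /eigenvalue /eigenspace !kermx_eq0 !row_free_unit.
  by rewrite -unitmx_tr linearB /= tr_scalar_mx.
apply: (iffP eigenvalueP) => -[y My y0].
  exists y^T; rewrite ?trmx_eq0 //.
  by rewrite -[RHS]linearZ /= -My trmx_mul trmxK.
exists y^T; rewrite ?trmx_eq0 //.
by rewrite -trmx_mul My linearZ.
Qed.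

Lemma min_nonneg_eigenvalue_uniq (R : realType) n (M : 'M[R]_n) a b :
  min_nonneg_eigenvalue M a -> min_nonneg_eigenvalue M b -> a = b.
Proof.
move=> [ea a0 mina] [eb b0 minb]; apply/eqP.
by rewrite eq_le mina ?minb.
Qed.

Section Pencil.
Variables (R : realType) (n : nat) (S B : 'M[R]_n).
Hypotheses (symS : S^T = S) (symB : B^T = B) (BB : B *m B = 1%:M).
Hypothesis psdS : forall u, 0 <= qform S u.
Hypothesis Bpos : exists w, 0 < qform B w.

Lemma pencilE a (y : 'cV_n) : B *m S *m y = a *: y <-> S *m y = a *: (B *m y).
Proof.
split=> [h|h]; last by rewrite -mulmxA h -scalemxAr mulmxA BB mul1mx.
by rewrite scalemxAr -h !mulmxA BB mul1mx.
Qed.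

Lemma qform_eigenvector a y : B *m S *m y = a *: y ->
  qform S y = a * qform B y.
Proof.
by move=> /pencilE h; rewrite /qform -!mulmxA h -scalemxAr mxE.
Qed.

(** Equality at [y] says that [y] is a zero of the positive semidefinite form
    [S - a B]. *)
Lemma eigenvector_of_tight a y : (forall u, a * qform B u <= qform S u) ->
  qform S y = a * qform B y -> B *m S *m y = a *: y.
Proof.
move=> le_aB tight; apply/pencilE/eqP; rewrite -subr_eq0; apply/eqP.
have := @psd_kernel _ _ (S - a *: B) y.
rewrite linearB linearZ /= symS symB mulmxBl -scalemxAl; apply=> //.
  by move=> u; rewrite qformB qformZ subr_ge0.
by rewrite qformB qformZ tight subrr.
Qed.

Lemma positive_definite : ~~ eigenvalue (B *m S) 0 ->
  forall u, u != 0 -> 0 < qform S u.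
Proof.
move=> N0 u u0; rewrite lt_def psdS andbT; apply: contraNneq N0 => Su0.
apply/eigenvalue_colP; exists u => //.
by rewrite scale0r -mulmxA (psd_kernel symS psdS Su0) mulmx0.
Qed.

(** When 0 is not an eigenvalue, [lam] is the inverse of the maximum of
    [qform B / qform S]: a nonnegative eigenvalue [nu] with eigenvector [z] is
    positive and its inverse is the value of this quotient at [z].  When 0 is an
    eigenvalue it may have no eigenvector with [qform B v = 1], whence the
    hypothesis in the last clause. *)
Lemma pencil_min_eigenvalue : exists lam,
  [/\ min_nonneg_eigenvalue (B *m S) lam,
      forall u, lam * qform B u <= qform S u
    & ~~ eigenvalue (B *m S) 0 ->
      exists2 v, B *m S *m v = lam *: v & qform B v = 1].
Proof.
have [ev0|N0] := boolP (eigenvalue (B *m S) 0).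
  by exists 0; split=> // u; rewrite mul0r.
have posS := positive_definite N0; have [w Bw] := Bpos.
have w0 : w != 0.
  by apply: contraTneq Bw => ->; rewrite /qform mulmx0 mxE ltxx.
have [u [mu [u0 Bu Bmax]]] := rayleigh_max B w0 posS.
have mu0 : 0 < mu.
  by have := lt_le_trans Bw (Bmax w); rewrite pmulr_lgt0 ?posS.
have le_S z : mu^-1 * qform B z <= qform S z.
  by rewrite mulrC ler_pdivrMr // mulrC.
have Bu0 : 0 < qform B u by rewrite Bu mulr_gt0 ?posS.
have eigu : B *m S *m u = mu^-1 *: u.
  by apply: eigenvector_of_tight => //; rewrite Bu mulKf ?gt_eqF.
exists mu^-1; split=> //.
  split; first by apply/eigenvalue_colP; exists u.
    by rewrite invr_ge0 ltW.
  move=> nu /eigenvalue_colP [z eigz z0] nu0.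
  have Sz := posS z z0; have := qform_eigenvector eigz => Snu.
  have nu1 : 0 < nu.
    rewrite lt_def nu0 andbT; apply: contraTneq Sz => nuE.
    by rewrite Snu nuE mul0r ltxx.
  by have := le_S z; rewrite Snu ler_pM2r // -(pmulr_rgt0 _ nu1) -Snu.
exists ((Num.sqrt (qform B u))^-1 *: u).
  by rewrite -scalemxAr eigu scalerA mulrC -scalerA.
by rewrite qform_scale exprVn sqr_sqrtr ?mulVf ?gt_eqF // ltW.
Qed.

(** Any minimal nonnegative eigenvalue is the one just constructed. *)
Lemma qform_min_eigenvalue_le lam : min_nonneg_eigenvalue (B *m S) lam ->
  forall u, lam * qform B u <= qform S u.
Proof.
move=> minlam; have [lam' [min' le' _]] := pencil_min_eigenvalue.
by rewrite (min_nonneg_eigenvalue_uniq minlam min').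
Qed.

End Pencil.

(** * The conformal coordinates *)

Lemma val_mid k : mid k = k.+2 :> nat.
Proof. by rewrite /mid inordK //; case: k => -[|[|[|[|]]]]. Qed.

Lemma sum_Qal (R : realType) w (v : 'cV[R]_4) (F : 'I_8 -> R) :
  \sum_j F j * Qal w v j 0 = F (inord 1) * w + \sum_k F (mid k) * v k 0.
Proof.
under eq_bigr => j _ do rewrite -[j in F j]inord_val mxE.
under [in RHS]eq_bigr => k _ do rewrite /mid -[k in v k]inord_val.
by rewrite !big_ord_recl !big_ord0 /= !mulr0 !addr0 add0r.
Qed.

Lemma qform_Qal (R : realType) (A : 'M[R]_8) w (v : 'cV[R]_4) : A^T = A ->
  qform A (Qal w v) =
    P0al A * w ^+ 2 + 2 * w * (P1al A *m v) 0 0 + qform (Pc A) v.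
Proof.
move=> symA; pose F j := \sum_k A j k * Qal w v k 0.
have -> : qform A (Qal w v) = \sum_j F j * Qal w v j 0.
  rewrite qformE; apply: eq_bigr => j _; rewrite mulr_suml.
  by apply: eq_bigr => k _; rewrite -mulrA mulrC.
rewrite sum_Qal /F sum_Qal.
under [X in _ + X]eq_bigr => k _ do rewrite sum_Qal mulrDl.
rewrite big_split /=.
have P1E : (P1al A *m v) 0 0 = \sum_k A (inord 1) (mid k) * v k 0.
  by rewrite mxE; apply: eq_bigr => k _; rewrite mxE.
have -> : \sum_k A (mid k) (inord 1) * w * v k 0 = w * (P1al A *m v) 0 0.
  rewrite P1E mulr_sumr; apply: eq_bigr => k _.
  by rewrite -[A in LHS]symA mxE mulrAC mulrC.
have -> : \sum_k (\sum_l A (mid k) (mid l) * v l 0) * v k 0 = qform (Pc A) v.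
  rewrite qformE; apply: eq_bigr => k _; rewrite mulr_suml.
  by apply: eq_bigr => l _; rewrite mxE mulrC mulrA.
rewrite -P1E /P0al; ring.
Qed.

Lemma gacB_sym (R : realType) : (gacB R)^T = gacB R.
Proof.
apply/matrixP => j k; rewrite !mxE -!val_eqE /=.
by case: j k => -[|[|[|[|[|[|[|[|]]]]]]]] // ? [] [|[|[|[|[|[|[|[|]]]]]]]].
Qed.

Lemma gacBc_sym (R : realType) : (gacBc R)^T = gacBc R.
Proof. by rewrite /gacBc trmx_mxsub gacB_sym. Qed.

Lemma gacBc_invol (R : realType) : gacBc R *m gacBc R = 1%:M.
Proof.
apply/matrixP => i j; rewrite !mxE.
under eq_bigr => k _ do rewrite !mxE -!val_eqE /= !val_mid.
rewrite !big_ord_recl big_ord0 -val_eqE.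
case: i j => -[|[|[|[|]]]] // ? [] [|[|[|[|]]]] //= ?; rewrite /bump /=; ring.
Qed.

(** The coordinate [w] is isotropic, and pairs only with the seventh coordinate,
    which is 0 in [Qal w v]. *)
Lemma ginner_Qal (R : realType) w (v : 'cV[R]_4) :
  ginner (Qal w v) (Qal w v) = qform (gacBc R) v.
Proof.
rewrite -[LHS]/(qform (gacB R) (Qal w v)) qform_Qal ?gacB_sym //.
have -> : P0al (gacB R) = 0 by rewrite /P0al mxE /= inordK.
have -> : P1al (gacB R) = 0.
  apply/rowP => k; rewrite !mxE -val_eqE /= val_mid inordK //.
  by case: k => -[|[|[|[|]]]].
by rewrite mul0mx mxE mul0r mulr0 !add0r.
Qed.

Lemma gacBc_pos (R : realType) : exists w, 0 < qform (gacBc R) w.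
Proof.
(* The basis vector [e_1], where the form takes the value 1. *)
exists (delta_mx (inord 1) 0).
by rewrite /qform trmx_delta -rowE -colE !mxE -val_eqE /= val_mid inordK /=.
Qed.

(** * The objective function *)

Definition schur (R : realType) (P : 'M[R]_8) : 'M[R]_4 :=
  Pc P - (P1al P)^T *m ((P0al P)^-1 *: P1al P).

Section Objective.
Variables (R : realType) (N : nat) (x y : 'I_N -> R).
Let P := dataP x y.
Hypothesis P0N0 : P0al P != 0.

Lemma dataP_sym : P^T = P.
Proof.
rewrite /P /dataP raddf_sum; apply: eq_bigr => i _ /=.
by rewrite !trmx_mul trmxK gacB_sym !mulmxA.
Qed.

Lemma objectiveE Q : objective x y Q = qform P Q.
Proof.
rewrite /qform /P /dataP mulmx_sumr mulmx_suml summxE; apply: eq_bigr => i _.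
set B := gacB R; set p := cpoint (x i) (y i).
have -> : Q^T *m (B *m p *m p^T *m B) *m Q =
    (p^T *m B *m Q)^T *m (p^T *m B *m Q).
  by rewrite !trmx_mul trmxK gacB_sym !mulmxA.
by rewrite [RHS]mxE big_ord1 [in X in X * _]mxE expr2.
Qed.

Lemma objective_ge0 Q : 0 <= objective x y Q.
Proof. by apply: sumr_ge0 => i _; exact: sqr_ge0. Qed.

Lemma schur_sym : (schur P)^T = schur P.
Proof.
rewrite /schur linearB /= trmx_mul linearZ /= trmxK -scalemxAr -scalemxAl.
by rewrite /Pc trmx_mxsub dataP_sym.
Qed.

Lemma qform_schur v :
  qform (schur P) v = qform (Pc P) v - (P0al P)^-1 * (P1al P *m v) 0 0 ^+ 2.
Proof.
rewrite /schur qformB -scalemxAr qformZ; congr (_ - _ * _).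
rewrite /qform !mulmxA -mulmxA mxE big_ord1 expr2 -trmx_mul.
by rewrite [in X in X * _]mxE.
Qed.

(** Completing the square in [w]. *)
Lemma objective_Qal w v : objective x y (Qal w v) =
  P0al P * (w - wal P v) ^+ 2 + qform (schur P) v.
Proof.
rewrite objectiveE qform_Qal ?dataP_sym // qform_schur /wal.
by field.
Qed.

(** The form of [schur P] is the objective at the best choice of [w]. *)
Lemma schur_psd v : 0 <= qform (schur P) v.
Proof.
have := objective_ge0 (Qal (wal P v) v).
by rewrite objective_Qal subrr expr0n mulr0 add0r.
Qed.

(** [P0al P] is the objective at the second basis vector. *)
Lemma P0al_gt0 : 0 < P0al P.
Proof.
rewrite lt_def P0N0; have := objective_ge0 (Qal 1 0).
by rewrite objectiveE qform_Qal ?dataP_sym // /qform !mulmx0 mxE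
  expr1n !mulr1 mulr0 !addr0.
Qed.

End Objective.

Theorem proposition2 (R : realType) (N : nat) (x y : 'I_N -> R) :
  let P := dataP x y in
  P0al P != 0 ->
  [/\ forall v, normalised_min_eigenvector (Pcon P) v ->
        is_solution x y (Qal (wal P v) v),
      (exists v, normalised_min_eigenvector (Pcon P) v) ->
        forall Q, is_solution x y Q ->
          exists2 v, normalised_min_eigenvector (Pcon P) v & Q = Qal (wal P v) v,
      exists lam, min_nonneg_eigenvalue (Pcon P) lam
    & ~~ eigenvalue (Pcon P) 0 ->
        exists v, normalised_min_eigenvector (Pcon P) v].
Proof.
move=> P P0N0; have P0 := P0al_gt0 P0N0.
have symS := schur_sym x y; have psdS := schur_psd P0N0.
have symB := gacBc_sym R; have BB := gacBc_invol R.
have leS := qform_min_eigenvalue_le symS symB BB psdS (gacBc_pos R).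
have [lam [minlam _ exv]] :=
  pencil_min_eigenvalue symS symB BB psdS (gacBc_pos R).
have obj_opt v mu : Pcon P *m v = mu *: v -> qform (gacBc R) v = 1 ->
    objective x y (Qal (wal P v) v) = mu.
  move=> /(qform_eigenvector BB) Sv Bv.
  by rewrite objective_Qal // subrr expr0n mulr0 add0r Sv Bv mulr1.
split.
- move=> v [[mu minmu eigv] Bv].
  split; first by split; [exists (wal P v), v | rewrite ginner_Qal].
  move=> _ [[w [u ->]]]; rewrite ginner_Qal (obj_opt v mu) // => Bu.
  have := leS _ minmu u; rewrite Bu mulr1 objective_Qal // => /le_trans; apply.
  by rewrite lerDr mulr_ge0 ?sqr_ge0 // ltW.
- move=> [v [[mu minmu eigv] Bv]] _ [[[w [u ->]]]].
  rewrite ginner_Qal => Bu optQ.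
  have le_mu : P0al P * (w - wal P u) ^+ 2 + qform (schur P) u <= mu.
    rewrite -objective_Qal // -(obj_opt v mu) //; apply: optQ.
    by split; [exists (wal P v), v | rewrite ginner_Qal].
  have ge_mu := leS _ minmu u; rewrite Bu mulr1 in ge_mu.
  have sq0 : 0 <= P0al P * (w - wal P u) ^+ 2.
    by rewrite mulr_ge0 ?sqr_ge0 // ltW.
  (* [le_mu] and [ge_mu] leave no room: the square vanishes and [u] is tight. *)
  have -> : w = wal P u.
    have /eqP : P0al P * (w - wal P u) ^+ 2 = 0 by lra.
    by rewrite mulf_eq0 (negbTE P0N0) sqrf_eq0 subr_eq0 => /eqP.
  exists u => //; split=> //; exists mu => //.
  apply: (eigenvector_of_tight symS symB BB); first exact: leS.
  by rewrite Bu mulr1; lra.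
- by exists lam.
- by move=> /exv[v eigv Bv]; exists v; split=> //; exists lam.
Qed.
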